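(* Let $G=(A,E)$ be an anti-cycle graph on $|A|\ge 8$ vertices, labeled $A=\{1,\dots,|A|\}$ so that the pairs of non-adjacent vertices are exactly $\{i,i+1\}$ for $i\in A$, with labels taken modulo $|A|$ (so $|A|+1\equiv 1$). Then, for every $i\in A$ and every $k\in\{i+4,\dots,|A|+i-2\}$, the inequality $$\sum_{j=i}^{i+3}x_j+x_k+x_{k+1}\le 3$$ (labels modulo $|A|$) induces a facet of $\mathscr{P}_{IUC}(G)$.
   Context: All graphs are finite, simple and undirected. A subset $U\subseteq V$ of the vertices of $G=(V,E)$ is an independent union of cliques (IUC) if every connected component of the induced subgraph $G[U]$ is a complete graph (equivalently, $G[U]$ has no induced path on three vertices). The IUC polytope $\mathscr{P}_{IUC}(G)\subseteq\mathbb{R}^{V}$ is the convex hull of the incidence vectors of all IUCs of $G$. An anti-cycle graph is the (edge) complement of a cycle graph. *)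

(* Defs.v *)
From mathcomp Require Import all_boot all_order all_algebra.

Set Implicit Arguments.
Unset Strict Implicit.
Unset Printing Implicit Defensive.

Import GRing.Theory Num.Theory.
Local Open Scope ring_scope.

Definition simple_graph (A : finType) (E : rel A) : Prop :=
  symmetric E /\ irreflexive E.

Definition complement_graph (A : finType) (E : rel A) : rel A :=
  [rel u v | (u != v) && ~~ E u v].

(* Vertices are labeled by naturals read modulo #|A|; since the labels take
   #|A| distinct values, every vertex has one. *)
Definition cyclic_labeling (A : finType) (lab : nat -> A) : Prop :=
  forall i j : nat, lab i = lab j <-> (i = j %[mod #|A|])%N.

Definition cycle_graph (A : finType) (E : rel A) (lab : nat -> A) : Prop :=
  cyclic_labeling lab /\
  forall u v : A, E u v <->
    exists i : nat, (u = lab i /\ v = lab i.+1) \/ (u = lab i.+1 /\ v = lab i).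

Definition anticycle_graph (A : finType) (E : rel A) (lab : nat -> A) : Prop :=
  simple_graph E /\ cycle_graph (complement_graph E) lab.

Definition induced (A : finType) (E : rel A) (U : {set A}) : rel A :=
  [rel u v | [&& u \in U, v \in U & E u v]].

Definition IUC (A : finType) (E : rel A) (U : {set A}) : Prop :=
  forall u v : A, u \in U -> v \in U ->
    connect (induced E U) u v -> u != v -> E u v.

Definition convex_hull (R : realFieldType) (V : lmodType R)
    (S : V -> Prop) (x : V) : Prop :=
  exists (m : nat) (w : 'I_m -> R) (p : 'I_m -> V),
    [/\ forall t, 0 <= w t, \sum_t w t = 1, forall t, S (p t)
      & x = \sum_t w t *: p t].

(* R^A is {ffun A -> R^o}; R^o is R as a module over itself, which the
   lmodType structure on finite functions requires. *)
Definition incidence (R : realFieldType) (A : finType) (U : {set A}) :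
    {ffun A -> R^o} := [ffun v => (v \in U)%:R].

Definition IUC_polytope (R : realFieldType) (A : finType) (E : rel A) :
    {ffun A -> R^o} -> Prop :=
  convex_hull (fun x => exists2 U : {set A}, IUC E U & x = incidence R U).

Definition affinely_independent (R : realFieldType) (V : lmodType R)
    (m : nat) (p : 'I_m -> V) : Prop :=
  forall c : 'I_m -> R,
    \sum_t c t = 0 -> \sum_t c t *: p t = 0 -> forall t, c t = 0.

Definition has_dim (R : realFieldType) (V : lmodType R)
    (S : V -> Prop) (d : nat) : Prop :=
  (exists2 p : 'I_d.+1 -> V, affinely_independent p & forall t, S (p t)) /\
  (forall (m : nat) (p : 'I_m -> V),
     affinely_independent p -> (forall t, S (p t)) -> (m <= d.+1)%N).

(* The inequality f x <= b, for a linear functional f, is valid for P and the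
   face that it induces has dimension dim P - 1. *)
Definition induces_facet (R : realFieldType) (V : lmodType R)
    (P : V -> Prop) (f : V -> R) (b : R) : Prop :=
  [/\ scalar f, forall x, P x -> f x <= b
    & exists2 d : nat, has_dim P d.+1 & has_dim (fun x => P x /\ f x = b) d].

(* Main.v *)
(** The complement of [G] is a cycle, so no cycle edge inside an IUC has a third
    member of that IUC cycle-nonadjacent to both of its ends.  Validity is then
    a Boolean check on the six vertices of the inequality.  As the right-hand
    side is nonzero, the face has dimension [#|A| - 1] as soon as no nonzero
    functional [a] vanishes on all of its IUCs.  The IUCs [{i,i+1,i+2}],
    [{i+1,i+2,i+3}] and the cycle-independent triples made of two elements of
    [{i,..,i+3}] and one of [{k,k+1}] force [a] to be zero on the six vertices;
    any other vertex extends a suitable such triple to a cycle-independent set,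
    so [a] vanishes there too. *)
From HB Require Import structures.
Require Import Defs.
From mathcomp Require Import all_boot all_order all_algebra.
From mathcomp Require Import zify lra.

Set Implicit Arguments.
Unset Strict Implicit.
Unset Printing Implicit Defensive.

Import GRing.Theory Num.Theory.
Local Open Scope ring_scope.

(** * Linear and affine independence, and a sufficient condition for a facet *)

Definition linearly_independent (R : realFieldType) (V : lmodType R)
    (m : nat) (p : 'I_m -> V) : Prop :=
  forall c : 'I_m -> R, \sum_t c t *: p t = 0 -> forall t, c t = 0.

Section Dimension.

Variables (R : realFieldType) (A : finType).
Local Notation V := {ffun A -> R^o}.

Definition coord_mx (m : nat) (p : 'I_m -> V) : 'M[R]_(m, #|A|) :=
  \matrix_(t, j) p t (enum_val j).

Lemma mul_coord_mx (m : nat) (p : 'I_m -> V) (c : 'rV[R]_m) (v : A) :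
  (c *m coord_mx p) 0 (enum_rank v) = (\sum_t c 0 t *: p t) v.
Proof.
rewrite mxE sum_ffunE; apply: eq_bigr => t _.
by rewrite mxE enum_rankK ffunE.
Qed.

Lemma linearly_independent_leq (m : nat) (p : 'I_m -> V) :
  linearly_independent p -> (m <= #|A|)%N.
Proof.
move=> p_free; suff /eqP <- : row_free (coord_mx p) by exact: rank_leq_col.
apply: inj_row_free => c c0; apply/rowP => t; rewrite mxE.
apply: p_free t; apply/ffunP => v.
by rewrite -mul_coord_mx c0 mxE ffunE.
Qed.

(** A column of ones prepended to the coordinates turns affine independence into independence of
    rows of length [1 + #|A|]. *)
Lemma affinely_independent_leq (m : nat) (p : 'I_m -> V) :
  affinely_independent p -> (m <= #|A|.+1)%N.
Proof.
move=> p_free.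
suff /eqP <- : row_free (row_mx (const_mx 1 : 'cV[R]_m) (coord_mx p)).
  exact: rank_leq_col.
apply: inj_row_free => c; rewrite mul_mx_row -row_mx0 => /eq_row_mx[c1 c0].
apply/rowP => t; rewrite mxE; apply: p_free t.
  move/rowP/(_ 0): c1; rewrite !mxE => c1; rewrite -[RHS]c1.
  by apply: eq_bigr => t _; rewrite mxE mulr1.
by apply/ffunP => v; rewrite -mul_coord_mx c0 mxE ffunE.
Qed.

(** The hypothesis says that the columns of the coordinate matrix are independent; its rank is then
    [#|A|], and that many rows form an invertible matrix. *)
Lemma linearly_independent_subfamily (T : finType) (p : T -> V) :
    (forall a : A -> R, (forall t, \sum_v a v * p t v = 0) ->
       forall v, a v = 0) ->
  exists g : 'I_#|A| -> T, linearly_independent (p \o g).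
Proof.
move=> p_sep; pose M := coord_mx (p \o enum_val : 'I_#|T| -> V).
have M_full : row_full M.
  rewrite /row_full -mxrank_tr; apply: inj_row_free => a aM.
  apply/rowP => j; rewrite mxE -[j]enum_valK.
  apply: (p_sep (fun v => a 0 (enum_rank v))) => t.
  have := congr1 (fun B : 'rV_ _ => B 0 (enum_rank t)) aM.
  rewrite !mxE => aMt; rewrite -[RHS]aMt.
  rewrite (reindex (@enum_val _ A)) /=; last exact/onW_bij/enum_val_bij.
  by apply: eq_bigr => s _; rewrite !mxE /= enum_valK enum_rankK.
exists (enum_val \o fullrankfun M_full) => c c0 t.
have := fullrowsub_unit M_full; rewrite -row_free_unit.
move/row_free_inj/(_ (\row_s c s) 0); rewrite mul0mx => c_inj.
suff /rowP/(_ t) : \row_s c s = 0 by rewrite !mxE.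
apply: c_inj; apply/rowP => j; rewrite !mxE.
have := congr1 (fun x : V => x (enum_val j)) c0.
rewrite sum_ffunE ffunE => c0j; rewrite -[RHS]c0j.
by apply: eq_bigr => s _; rewrite [RHS]ffunE !mxE.
Qed.

(** The family contains [#|A|] independent points of the face. Adding the origin gives the dimension
    of [P]. Applying [f] to a vanishing combination of face points gives [b] times the sum of its
    coefficients, so on the face affine independence is linear independence. *)
Lemma induces_facet_separating (P : V -> Prop) (f : V -> R) (b : R)
    (T : finType) (p : T -> V) :
    scalar f -> (forall x, P x -> f x <= b) -> b != 0 -> (0 < #|A|)%N ->
    P 0 -> (forall t, P (p t) /\ f (p t) = b) ->
    (forall a : A -> R, (forall t, \sum_v a v * p t v = 0) ->
       forall v, a v = 0) ->
  induces_facet P f b.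
Proof.
move=> f_lin f_le b0 A0 P0 p_face p_sep; split=> //.
pose fL : {scalar V} := HB.pack f (GRing.isLinear.Build R V R _ f f_lin).
have [g g_free] := linearly_independent_subfamily p_sep.
have pg_face t : P ((p \o g) t) /\ f ((p \o g) t) = b by exact: p_face.
move: (p \o g) g_free pg_face => {g p p_face p_sep}.
have up_lin := @linearly_independent_leq.
have up_aff := affinely_independent_leq.
case: #|A| A0 up_lin up_aff => // d _ up_lin up_aff q q_free q_face.
exists d; split.
(* Index [ord0] carries the origin; the others carry the points [q]. *)
- exists (fun t => oapp q 0 (unlift ord0 t)); last first.
    by move=> t; case: unliftP => [s|] _ //=; case: (q_face s).
  move=> c; rewrite big_ord_recl => c_sum.
  rewrite big_ord_recl unlift_none /= scaler0 add0r => c_comb.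
  have c_lift t : c (lift ord0 t) = 0.
    apply: (q_free (fun t => c (lift ord0 t))); rewrite -[RHS]c_comb.
    by apply: eq_bigr => s _; rewrite liftK.
  move=> t; case: (unliftP ord0 t) => [s|] -> //.
  by rewrite -[RHS]c_sum big1 ?addr0.
- by move=> m p p_free _; exact: up_aff p_free.
- by exists q => // c _; exact: q_free.
- move=> m p p_free p_face; apply: (up_lin m p) => c c0; apply: p_free => //.
  have : fL (\sum_t c t *: p t) = 0 by rewrite c0 linear0.
  rewrite linear_sum /= (eq_bigr (fun t => c t * b)) => [|t _].
    by rewrite -mulr_suml => /eqP; rewrite mulf_eq0 (negPf b0) orbF => /eqP.
  by rewrite -[f _]/(fL _) linearZ /=; case: (p_face t) => _ ->.
Qed.

Lemma convex_hull_le (W : lmodType R) (S : W -> Prop) (f : W -> R) (b : R) :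
    scalar f -> (forall x, S x -> f x <= b) ->
  forall x, convex_hull S x -> f x <= b.
Proof.
move=> f_lin f_le x [m [w [p [w_ge0 w_sum pS ->]]]].
pose fL : {scalar W} := HB.pack f (GRing.isLinear.Build R W R _ f f_lin).
rewrite -[f _]/(fL _) linear_sum -[leRHS]mul1r -w_sum mulr_suml.
apply: ler_sum => t _; rewrite linearZ /=.
by apply: ler_wpM2l => //; apply: f_le.
Qed.

Lemma convex_hull_incl (W : lmodType R) (S : W -> Prop) (x : W) :
  S x -> convex_hull S x.
Proof.
move=> Sx; exists 1%N, (fun=> 1), (fun=> x); split=> //.
  by rewrite big_ord1.
by rewrite big_ord1 scale1r.
Qed.

End Dimension.

(** * Independent unions of cliques in a general graph *)

Section IndependentUnionsOfCliques.

Variables (A : finType) (E : rel A).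

(** The Boolean form allows the tight IUCs to be collected in a finite type. *)
Definition IUCb (U : {set A}) : bool :=
  [forall u in U, forall v in U,
     connect (induced E U) u v ==> (u != v) ==> E u v].

Lemma IUCP (U : {set A}) : reflect (IUC E U) (IUCb U).
Proof.
apply: (iffP idP) => [/forall_inP U_iuc u v uU vU uv neq | U_iuc].
  by have /forall_inP/(_ v vU)/implyP/(_ uv)/implyP/(_ neq) := U_iuc u uU.
apply/forall_inP => u uU; apply/forall_inP => v vU.
by apply/implyP => uv; apply/implyP; apply: U_iuc.
Qed.

Lemma clique_IUC (U : {set A}) :
  {in U &, forall u v, u != v -> E u v} -> IUC E U.
Proof. by move=> U_cl u v uU vU _; apply: U_cl. Qed.

Lemma IUC_no_path3 (U : {set A}) (u v w : A) :
    symmetric E -> IUC E U -> u \in U -> v \in U -> w \in U ->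
  u != v -> E w u -> E w v -> E u v.
Proof.
move=> symE U_iuc uU vU wU neq Ewu Ewv; apply: U_iuc => //.
apply: (@connect_trans _ _ w); apply: connect1; rewrite /induced /=.
  by rewrite uU wU symE.
by rewrite vU wU.
Qed.

(** The components are the edge between [u] and [w], and the isolated vertex [v]. *)
Lemma IUC_edge_isolated (u v w : A) :
    symmetric E -> E u w -> ~~ E v u -> ~~ E v w -> ~~ E v v ->
  IUC E [set u; v; w].
Proof.
move=> symE Euw nvu nvw nvv.
pose e := induced E [set u; v; w].
have e_sym : connect_sym e.
  by apply: sym_connect_sym => x y; rewrite /e /induced /= symE andbCA.
have v_isol x : connect e v x -> x = v.
  case/connectP => [[|y s]] //= /andP[/and3P[_ + Evy] _] _.
  rewrite !inE -orbA => /or3P[] /eqP yE; move: Evy;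
    by rewrite yE ?(negPf nvu) ?(negPf nvw) ?(negPf nvv).
move=> x y; rewrite !inE -!orbA.
case/or3P=> /eqP-> /or3P[] /eqP->; rewrite ?eqxx ?(symE w) //=.
- by rewrite -/e e_sym => /v_isol-> /eqP.
- by move=> /v_isol-> /eqP.
- by move=> /v_isol-> /eqP.
- by rewrite -/e e_sym => /v_isol-> /eqP.
Qed.

End IndependentUnionsOfCliques.

(** * Labels and adjacency in the anti-cycle *)

Section AntiCycle.

Variables (A : finType) (E : rel A) (lab : nat -> A) (n : nat).
Hypotheses (cardA : #|A| = n) (n_ge8 : (8 <= n)%N).
Hypothesis hE : anticycle_graph E lab.

Lemma eq_lab_mod (x y : nat) : lab x = lab y <-> x = y %[mod n].
Proof. by rewrite -cardA; apply: hE.2.1. Qed.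

Lemma lab_eq (x y : nat) : (x <= y < x + n)%N -> (lab x == lab y) = (x == y).
Proof.
move=> xy; apply/eqP/eqP => [/eq_lab_mod/eqP|-> //].
rewrite eq_sym eqn_mod_dvd; last by case/andP: xy.
case: (posnP (y - x)) => [|yx_gt0 /(dvdn_leq yx_gt0)]; lia.
Qed.

(** An injection from [n] consecutive labels into [n] vertices is onto. *)
Lemma lab_window (i : nat) (v : A) :
  exists2 j, (i <= j < i + n)%N & v = lab j.
Proof.
pose h (j : 'I_n) := lab (i + j).
have h_inj : injective h.
  move=> x y /eq_lab_mod/eqP; rewrite eqn_modDl !modn_small // => /eqP.
  exact: val_inj.
have /codomP[j ->] : v \in codom h.
  by apply: inj_card_onto h_inj _ v; rewrite card_ord cardA.
by exists (i + j)%N; rewrite // leq_addr ltn_add2l ltn_ord.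
Qed.

(** In the window starting at [x], the cycle neighbours of [x] are [x + 1] and [x + n - 1];
    adjacency thus becomes linear arithmetic. *)
Lemma anticycle_edge (x y : nat) : (x < y < x + n)%N ->
  E (lab x) (lab y) = (y != x.+1) && (y.+1 != x + n)%N.
Proof.
move=> xy; have neq : lab x != lab y by rewrite lab_eq; lia.
have cyc := hE.2.2.
suff C : complement_graph E (lab x) (lab y) = (y == x.+1) || (y.+1 == x + n)%N.
  by rewrite -negb_or -C /complement_graph /= neq negbK.
apply/idP/idP => [/cyc[j [] [/eq_lab_mod xj /eq_lab_mod yj]]|/orP[]/eqP yE].
- have /eqP : (y = x.+1 %[mod n])%N.
    by rewrite yj -(addn1 j) -(addn1 x) -modnDml -xj modnDml.
  rewrite eqn_mod_dvd; last lia.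
  by case: (posnP (y - x.+1)) => [|gt0 /(dvdn_leq gt0)]; lia.
- have /eqP : (y.+1 = x %[mod n])%N.
    by rewrite xj -(addn1 j) -(addn1 y) -modnDml yj modnDml.
  rewrite eqn_mod_dvd; last lia.
  (* A multiple of [n] strictly between [0] and [2n] is [n]. *)
  have gt0 : (0 < y.+1 - x)%N by lia.
  have lt2 : (y.+1 - x < n + n)%N by lia.
  by move/dvdnP=> [[|[|q]]]; nia.
- by apply/cyc; exists x; left; rewrite yE.
- apply/cyc; exists y; right; split=> //.
  by apply/eq_lab_mod; rewrite yE modnDr.
Qed.

Let symE : symmetric E. Proof. exact: hE.1.1. Qed.
Let irrE : irreflexive E. Proof. exact: hE.1.2. Qed.

Definition lab_set (s : seq nat) : {set A} := [set v in map lab s].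

Definition in_window (i : nat) (s : seq nat) : bool :=
  all (fun j => i <= j < i + n)%N s.

Lemma mem_lab_set (i j : nat) (s : seq nat) :
  (i <= j < i + n)%N -> in_window i s -> (lab j \in lab_set s) = (j \in s).
Proof.
move=> ij /allP s_win; rewrite inE; apply/mapP/idP => [[l ls]|js]; last first.
  by exists j.
have := s_win l ls => il /eqP.
case: (leqP j l) => jl; last rewrite eq_sym.
  by rewrite lab_eq; [move/eqP-> | lia].
by rewrite lab_eq; [move/eqP<- | lia].
Qed.

Lemma uniq_map_lab (i : nat) (s : seq nat) :
  in_window i s -> uniq s -> uniq (map lab s).
Proof.
elim: s => //= j s IH /andP[ij s_win] /andP[js us].
by rewrite IH // andbT; have := mem_lab_set ij s_win; rewrite inE => ->.
Qed.

Lemma sum_lab_set (R : realFieldType) (a : A -> R) (i : nat) (s : seq nat) :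
    in_window i s -> uniq s ->
  \sum_v a v * incidence R (lab_set s) v = \sum_(j <- s) a (lab j).
Proof.
move=> s_win /(uniq_map_lab s_win) us; rewrite -(big_map lab xpredT a).
rewrite (big_uniq _ us) [RHS]big_mkcond.
apply: eq_bigr => v _; rewrite ffunE inE.
by case: (v \in _); rewrite ?mulr1 ?mulr0.
Qed.

(* Forces [s] to be sorted and [lab_set s] to be independent in the cycle. *)
Definition spread (s : seq nat) : bool :=
  pairwise (fun x y => (x.+1 < y) && (y.+1 < x + n))%N s.

(** A cycle-independent set is a clique of the anti-cycle. *)
Lemma spread_IUC (s : seq nat) : spread s -> IUC E (lab_set s).
Proof.
move=> s_spr; apply: clique_IUC => u v; rewrite !inE.
elim: s s_spr => //= x s IH /andP[/allP x_spr s_spr].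
have x_adj (y : nat) : y \in s -> E (lab x) (lab y).
  by move=> /x_spr xy; rewrite anticycle_edge; lia.
rewrite !inE => /orP[/eqP->|us] /orP[/eqP->|vs]; rewrite ?eqxx //.
- by case/mapP: vs => y ys -> _; apply: x_adj.
- by case/mapP: us => y ys -> _; rewrite symE; apply: x_adj.
- exact: IH.
Qed.

(** The two ends are adjacent in [E], and the middle vertex is adjacent to neither. *)
Lemma consecutive_IUC (x : nat) : IUC E (lab_set [:: x; x.+1; x.+2]).
Proof.
have -> : lab_set [:: x; x.+1; x.+2] = [set lab x; lab x.+1; lab x.+2].
  by apply/setP => v; rewrite !inE orbA.
apply: IUC_edge_isolated => //; rewrite ?irrE // ?[E (lab x.+1) (lab x)]symE;
  rewrite anticycle_edge; lia.
Qed.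

(* [w] may lie on either side of the cycle edge, so it is represented in the
   window starting at [x]. *)
Lemma IUC_no_edge_far (U : {set A}) (x w : nat) :
    IUC E U -> (x.+2 < w < x + n - 1)%N ->
  ~~ [&& lab x \in U, lab x.+1 \in U & lab w \in U].
Proof.
move=> U_iuc xw; apply/and3P => -[xU x1U wU].
have : E (lab x) (lab x.+1).
  apply: (IUC_no_path3 symE U_iuc xU x1U wU).
  - by rewrite lab_eq; lia.
  - by rewrite symE anticycle_edge; lia.
  - by rewrite symE anticycle_edge; lia.
by rewrite anticycle_edge ?eqxx; lia.
Qed.

Lemma labDn (x : nat) : lab (x + n) = lab x.
Proof. by apply/eq_lab_mod; rewrite modnDr. Qed.

(** * Validity of the inequality *)

Variables (i k : nat).
Hypothesis hk : (i + 4 <= k <= n + i - 2)%N.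

(** The upper bound on [k] keeps [k.+1] below [i + n], so all six labels lie in one window. *)
Definition facet_labels : seq nat := [:: i; i.+1; i.+2; i.+3; k; k.+1].

(** Every four of the six vertices contain one of the nine forbidden sets below. *)
Lemma facet_labels_le (U : {set A}) : IUC E U ->
  (\sum_(j <- facet_labels) (lab j \in U) <= 3)%N.
Proof.
move=> U_iuc; rewrite !big_cons big_nil /=.
have far := IUC_no_edge_far U_iuc.
(* For a vertex labelled before the edge, adding [n] moves it into the window of the edge. *)
have wrap x w : (x.+2 < w + n < x + n - 1)%N ->
    ~~ [&& lab x \in U, lab x.+1 \in U & lab w \in U].
  by rewrite -(labDn w); apply: far.
have h013 : ~~ [&& lab i \in U, lab i.+1 \in U & lab i.+3 \in U].
  by apply: far; lia.
have h230 : ~~ [&& lab i.+2 \in U, lab i.+3 \in U & lab i \in U].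
  by apply: wrap; lia.
have h01k : ~~ [&& lab i \in U, lab i.+1 \in U & lab k \in U].
  by apply: far; lia.
have h12k : ~~ [&& lab i.+1 \in U, lab i.+2 \in U & lab k \in U].
  by apply: far; lia.
have h12l : ~~ [&& lab i.+1 \in U, lab i.+2 \in U & lab k.+1 \in U].
  by apply: far; lia.
have h23l : ~~ [&& lab i.+2 \in U, lab i.+3 \in U & lab k.+1 \in U].
  by apply: far; lia.
have hkl1 : ~~ [&& lab k \in U, lab k.+1 \in U & lab i.+1 \in U].
  by apply: wrap; lia.
have hkl2 : ~~ [&& lab k \in U, lab k.+1 \in U & lab i.+2 \in U].
  by apply: wrap; lia.
(* If [k = i + 4], then [i + 3] is next to [k] and [i] is the far vertex; otherwise [i + 3] is far,
   while [i] may be next to [k.+1]. *)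
have hkl03 : ~~ [&& lab k \in U, lab k.+1 \in U, lab i \in U & lab i.+3 \in U].
  case: (eqVneq k (i + 4)%N) => [k4|k4].
    have /negP h : ~~ [&& lab k \in U, lab k.+1 \in U & lab i \in U].
      by apply: wrap; lia.
    by apply/negP => /and4P[? ? ? _]; apply: h; apply/and3P.
  have /negP h : ~~ [&& lab k \in U, lab k.+1 \in U & lab i.+3 \in U].
    by apply: wrap; lia.
  by apply/negP => /and4P[? ? _ ?]; apply: h; apply/and3P.
move: h013 h230 h01k h12k h12l h23l hkl1 hkl2 hkl03.
by do 6!case: (_ \in U).
Qed.

(** * Functionals vanishing on all tight IUCs *)

Section Annihilator.

Variables (R : realFieldType) (a : A -> R).
Hypothesis a0 : forall U : {set A}, IUC E U ->
  (\sum_(j <- facet_labels) (lab j \in U) = 3)%N ->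
  \sum_v a v * incidence R U v = 0.

Lemma annihilator_sum (s : seq nat) :
    IUC E (lab_set s) -> in_window i s -> uniq s ->
    (\sum_(j <- facet_labels) (j \in s) = 3)%N ->
  \sum_(j <- s) a (lab j) = 0.
Proof.
move=> s_iuc s_win us s3; rewrite -(sum_lab_set a s_win us).
apply: a0 => //; rewrite -[RHS]s3; apply: eq_big_seq => j jI.
by rewrite (mem_lab_set _ s_win) //; move: jI; rewrite !inE; lia.
Qed.

Lemma annihilator_spread (s : seq nat) :
    spread s -> in_window i s ->
    (\sum_(j <- facet_labels) (j \in s) = 3)%N ->
  \sum_(j <- s) a (lab j) = 0.
Proof.
move=> s_spr s_win; apply: annihilator_sum => //; first exact: spread_IUC.
by apply: pairwise_uniq s_spr => x; lia.
Qed.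

Ltac facet_arith :=
  rewrite /spread /in_window /facet_labels ?big_cons ?big_nil /= ?inE; lia.

(** The consecutive triples give equal values at [i] and [i + 3]; the triples through [l] then make
    the first four values equal, and three of these sum to zero. *)
Lemma annihilator_facet_labels (j : nat) : j \in facet_labels -> a (lab j) = 0.
Proof.
have := annihilator_sum (@consecutive_IUC i).
have := annihilator_sum (@consecutive_IUC i.+1).
rewrite !big_cons !big_nil !addr0 /= => c2 c1.
have {}c1 : a (lab i) + (a (lab i.+1) + a (lab i.+2)) = 0.
  by apply: c1; facet_arith.
have {}c2 : a (lab i.+1) + (a (lab i.+2) + a (lab i.+3)) = 0.
  by apply: c2; facet_arith.
have tri x y z : spread [:: x; y; z] -> in_window i [:: x; y; z] ->
    (\sum_(j <- facet_labels) (j \in [:: x; y; z]) = 3)%N ->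
    a (lab x) + a (lab y) + a (lab z) = 0.
  move=> h1 h2 /(annihilator_spread h1 h2).
  by rewrite !big_cons big_nil addr0 addrA.
(* The label [l] must avoid the cycle neighbours of [i] and of [i + 3]. *)
have [l [t02 t03 t13]] : exists l,
    [/\ a (lab i) + a (lab i.+2) + a (lab l) = 0,
        a (lab i) + a (lab i.+3) + a (lab l) = 0
      & a (lab i.+1) + a (lab i.+3) + a (lab l) = 0].
  by case: (eqVneq k (i + 4)%N) => k4; [exists k.+1 | exists k];
    split; apply: tri; facet_arith.
have [ai [ai1 [ai2 ai3]]] : a (lab i) = 0 /\ a (lab i.+1) = 0 /\
    a (lab i.+2) = 0 /\ a (lab i.+3) = 0 by do !split; lra.
have [ak ak1] : a (lab k) = 0 /\ a (lab k.+1) = 0.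
  (* The pair must suit both [k] and [k.+1]: it avoids [i + 3] when [k = i + 4], and otherwise [i],
     which may follow [k.+1]. *)
  case: (eqVneq k (i + 4)%N) => k4.
    have tk : a (lab i) + a (lab i.+2) + a (lab k) = 0.
      by apply: tri; facet_arith.
    have tk1 : a (lab i) + a (lab i.+2) + a (lab k.+1) = 0.
      by apply: tri; facet_arith.
    by split; lra.
  have tk : a (lab i.+1) + a (lab i.+3) + a (lab k) = 0.
    by apply: tri; facet_arith.
  have tk1 : a (lab i.+1) + a (lab i.+3) + a (lab k.+1) = 0.
    by apply: tri; facet_arith.
  by split; lra.
by rewrite !inE => /or4P[/eqP->|/eqP->|/eqP->|/or3P[] /eqP->].
Qed.

Lemma annihilator_eq0 (v : A) : a v = 0.
Proof.
have [y y_win ->] := lab_window i v.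
case: (boolP (y \in facet_labels)) => [|yI].
  exact: annihilator_facet_labels.
(* The two positions of [y] keep the list sorted, as [spread] requires. *)
have quad (p q r : nat) s :
    p \in facet_labels -> q \in facet_labels -> r \in facet_labels ->
    s = [:: p; q; r; y] \/ s = [:: p; q; y; r] -> spread s -> in_window i s ->
    (\sum_(j <- facet_labels) (j \in s) = 3)%N -> a (lab y) = 0.
  move=> /annihilator_facet_labels p0 /annihilator_facet_labels q0.
  move=> /annihilator_facet_labels r0 sE s_spr s_win.
  move=> /(annihilator_spread s_spr s_win).
  by case: sE => ->; rewrite !big_cons big_nil p0 q0 r0; lra.
move: yI; rewrite !inE => yI.
have [yk|ky] := ltnP y k.
  have [y4|y4] := eqVneq y (i + 4)%N.
    have [k5|k5] := eqVneq k (i + 5)%N.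
      (* Here [k.+1] is [i + 6], not a cycle neighbour of [i] since [n] is at least 8. *)
      by apply: (quad i i.+2 k.+1 [:: i; i.+2; y; k.+1]);
  try tauto; facet_arith.
    by apply: (quad i i.+2 k [:: i; i.+2; y; k]);
  try tauto; facet_arith.
  have [yk1|yk1] := eqVneq y.+1 k.
    by apply: (quad i.+1 i.+3 k.+1 [:: i.+1; i.+3; y; k.+1]);
  try tauto; facet_arith.
  by apply: (quad i.+1 i.+3 k [:: i.+1; i.+3; y; k]);
  try tauto; facet_arith.
(* Now [y] is at least [k + 2]; the pair [i], [i + 2] serves unless [y] precedes [i] on the
   cycle. *)
have [yi|yi] := eqVneq y.+1 (i + n)%N.
  have [k4|k4] := eqVneq k (i + 4)%N.
    by apply: (quad i.+1 i.+3 k.+1 [:: i.+1; i.+3; k.+1; y]);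
  try tauto; facet_arith.
  by apply: (quad i.+1 i.+3 k [:: i.+1; i.+3; k; y]);
  try tauto; facet_arith.
by apply: (quad i i.+2 k [:: i; i.+2; k; y]);
  try tauto; facet_arith.
Qed.

End Annihilator.

End AntiCycle.

(** * The facet induced by the six-vertex inequality *)

Theorem theorem17 (R : realFieldType) (A : finType) (E : rel A)
    (lab : nat -> A) (hA : (8 <= #|A|)%N) (hE : anticycle_graph E lab)
    (i k : nat) (hi : (1 <= i <= #|A|)%N)
    (hk : (i + 4 <= k <= #|A| + i - 2)%N) :
  induces_facet (@IUC_polytope R A E)
    (fun x : {ffun A -> R^o} =>
       \sum_(i <= j < i + 4) x (lab j) + x (lab k) + x (lab k.+1))
    3%:R.
Proof.
set f := (fun x : {ffun A -> R^o} => _).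
have fE x : f x = \sum_(j <- facet_labels i k) x (lab j).
  rewrite /f; have -> : index_iota i (i + 4) = [:: i; i.+1; i.+2; i.+3].
    by rewrite /index_iota addKn.
  by rewrite !big_cons !big_nil !addr0 !addrA.
have f_lin : scalar f.
  move=> c x y; rewrite !fE mulr_sumr -big_split.
  by apply: eq_bigr => j _; rewrite /= !ffunE.
have f_inc U : f (incidence R U) =
    (\sum_(j <- facet_labels i k) (lab j \in U))%:R.
  by rewrite fE natr_sum; apply: eq_bigr => j _; rewrite ffunE.
(* The separating family consists of all IUCs attaining equality. *)
pose T := {U : {set A} | IUCb E U &&
  (\sum_(j <- facet_labels i k) (lab j \in U) == 3)%N}.
apply: (@induces_facet_separating _ _ _ f _ T (fun U => incidence R (val U))).
- exact: f_lin.
- apply: convex_hull_le => // x [U U_iuc ->].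
  by rewrite f_inc ler_nat; apply: facet_labels_le U_iuc.
- by rewrite pnatr_eq0.
- by apply: leq_trans hA.
- apply: convex_hull_incl; exists set0; first by move=> u v; rewrite inE.
  by apply/ffunP => v; rewrite !ffunE inE.
- move=> [U /= /andP[/IUCP U_iuc /eqP U3]]; rewrite f_inc U3; split=> //.
  by apply: convex_hull_incl; exists U.
- move=> a a0; apply: (annihilator_eq0 erefl hA hE hk) => U U_iuc U3.
  have UT : IUCb E U && (\sum_(j <- facet_labels i k) (lab j \in U) == 3)%N.
    by rewrite U3 eqxx andbT; apply/IUCP.
  exact: (a0 (Sub U UT)).
Qed.
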